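(* Assume: (1a) for all $i,j,t$: $\mathbb{E}[\epsilon_{it}\mid\boldsymbol{\mu}_j]=\mathbb{E}[\epsilon_{it}]=0$; (1b) for all $s\neq t$: $\mathbb{E}[\eta_{it}\mid\mu_{js}]=0$; (1c) for all $s\neq t$: $(\overline{\epsilon}_{jt},\overline{\eta}_{jt})$ is independent of $(\overline{\epsilon}_{js},\overline{\eta}_{js})$; (2a) $\mathbb{E}(\ddot{\boldsymbol X}_j'\ddot{\boldsymbol X}_j)$ is finite and invertible; (2b) $0<\mathrm{Var}(\mu^*_{jt})<\infty$; (2c) $\mathbb{E}(\ddot{\boldsymbol X}_j'\ddot{\boldsymbol\mu}_j)=0$, $\mathbb{E}(\ddot{\boldsymbol X}_j'\ddot{\boldsymbol\epsilon}_j)=0$ and $\mathbb{E}(\ddot{\boldsymbol X}_j'\ddot{\boldsymbol\eta}_j)=0$. Then $$\mathrm{Cov}(\overline\eta_{jt},\mu^*_{jt})=0\qquad\text{and}\qquad\frac{\mathrm{Cov}(\mu_{jt},\mu^*_{jt})}{\mathrm{Var}(\mu^*_{jt})}=1 .$$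
   Context: Teachers are indexed by $j=1,\dots,J$, years by $t=1,\dots,T$ ($T\ge 2$ fixed). In each year teacher $j$ teaches a class of $n_j$ students ($n_j$ constant over time). For student $i$ matched to teacher $j$ in year $t$, the observed test score and observed adult earnings are $$R^{obs}_{it}=X_{it}'\boldsymbol\beta_0+\mu_{jt}+\epsilon_{it},\qquad Y^{obs}_i=X_{it}'\boldsymbol\beta_0^Y+\kappa_0\mu_{jt}+\eta_{it},$$ with $X_{it}\in\mathbb{R}^K$ observed covariates, $\mu_{jt}$ the unobserved value added of teacher $j$ in year $t$, $\epsilon_{it},\eta_{it}$ unobserved scalars, and fixed parameters $\boldsymbol\beta_0,\boldsymbol\beta_0^Y\in\mathbb{R}^K$, $\kappa_0\in\mathbb{R}$. Value added has mean $0$ and is stationary: its mean does not vary with $t$ and the correlation of $\mu_{jt}$ and $\mu_{js}$ depends only on $|s-t|$. For a student-level variable $H$, $\overline H_{jt}=\frac1{n_j}\sum_i H_{it}$ is the class average (for $\mu$, $\overline\mu_{jt}=\mu_{jt}$) and $\ddot H_{jt}=\overline H_{jt}-\frac1T\sum_t\overline H_{jt}$. $\boldsymbol H_j$ stacks $\overline H_{jt}$ over $t$ and $\ddot{\boldsymbol H}_j$ stacks $\ddot H_{jt}$ over $t$; thus $\ddot{\boldsymbol X}_j$ is $T\times K$ and $\boldsymbol\mu_j,\ddot{\boldsymbol\mu}_j,\ddot{\boldsymbol\epsilon}_j,\ddot{\boldsymbol\eta}_j\in\mathbb{R}^T$. Residual test scores: $\overline R_{jt}=\overline R^{obs}_{jt}-\overline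 X_{jt}'\boldsymbol\beta_0=\mu_{jt}+\overline\epsilon_{jt}$. $\boldsymbol\phi_0=(\phi_{01},\dots,\phi_{0,T-1})'$ is the (unique) vector, common to all $t$, that for every $t$ minimizes $\mathbb{E}\big[(\overline R_{jt}-\sum_{s\neq t}\phi_{|s-t|}\overline R_{js})^2\big]$ over $\boldsymbol\phi\in\mathbb{R}^{T-1}$, and $\mu^*_{jt}=\sum_{s\neq t}\phi_{0|s-t|}\overline R_{js}$ is the resulting best linear predictor of $\overline R_{jt}$ from other years. Expectations are over the distribution of teacher $j$'s data; all expectations and covariances written are assumed to exist and be finite. *)

(* Defs.v *)
From HB Require Import structures.
From mathcomp Require Import all_boot all_order all_algebra.
From mathcomp Require Import all_classical all_reals all_analysis.
Set Implicit Arguments.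
Unset Strict Implicit.
Unset Printing Implicit Defensive.
Import Order.TTheory GRing.Theory Num.Theory.
Import numFieldNormedType.Exports.

Local Open Scope classical_set_scope.
Local Open Scope ring_scope.

Section Probability.
Context (R : realType) (d : measure_display) (Omega : measurableType d).
Variable P : probability Omega R.

(* Z is a version of E[X | G]; G is meant to be a sub-sigma-algebra. *)
Definition is_cond_exp (G : set (set Omega)) (X Z : Omega -> R) : Prop :=
  [/\ X \in Lfun P 1%E,
      Z \in Lfun P 1%E,
      (forall B : set R, measurable B -> G (Z @^-1` B)) &
      (forall A, G A ->
        (\int[P]_(w in A) (X w)%:E = \int[P]_(w in A) (Z w)%:E)%E)].

Definition indep_rv (d1 d2 : measure_display) (T1 : measurableType d1)
    (T2 : measurableType d2) (U : Omega -> T1) (V : Omega -> T2) : Prop :=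
  forall (A : set T1) (B : set T2), measurable A -> measurable B ->
    (P (U @^-1` A `&` V @^-1` B) = P (U @^-1` A) * P (V @^-1` B))%E.

(* Equal to 0 when one of the variances is 0. *)
Definition correlation (X Y : Omega -> R) : R :=
  fine (covariance P X Y) / Num.sqrt (fine 'V_P[X]%E * fine 'V_P[Y]%E).

Definition mx_integrable (m n : nat) (A : Omega -> 'M[R]_(m, n)) : Prop :=
  forall i k, (fun w => A w i k) \in Lfun P 1%E.

Definition mx_expectation (m n : nat) (A : Omega -> 'M[R]_(m, n)) :
    'M[R]_(m, n) :=
  \matrix_(i, k) fine ('E_P[fun w => A w i k])%E.

End Probability.

Section ValueAdded.
Context (R : realType) (d : measure_display) (Omega : measurableType d).
Variables (P : probability Omega R) (J T K : nat) (student : finType).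

(* [teacher i t = Some j] means that student [i] is in the class of teacher [j]
   in year [t]; a student who is in no class in year [t] is sent to [None].
   Values of [X], [eps], [eta], [Robs] at such a pair (i, t) are irrelevant. *)
Record va_model := VAModel {
  teacher : student -> 'I_T -> option 'I_J;
  class_size : 'I_J -> nat;
  beta0 : 'cV[R]_K;
  betaY0 : 'cV[R]_K;
  kappa0 : R;
  X : 'I_K -> student -> 'I_T -> {RV P >-> R};
  mu : 'I_J -> 'I_T -> {RV P >-> R};
  eps : student -> 'I_T -> {RV P >-> R};
  eta : student -> 'I_T -> {RV P >-> R};
  Robs : student -> 'I_T -> {RV P >-> R};
  Yobs : student -> {RV P >-> R};
  class_size_gt0 : forall j, (0 < class_size j)%N;
  card_class : forall j t,
    #|[set i | teacher i t == Some j]%SET| = class_size j;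
  RobsE : forall i j t, teacher i t = Some j -> forall w,
    Robs i t w =
      \sum_k X k i t w * beta0 k ord0 + mu j t w + eps i t w;
  YobsE : forall i j t, teacher i t = Some j -> forall w,
    Yobs i w =
      \sum_k X k i t w * betaY0 k ord0 + kappa0 * mu j t w + eta i t w
}.

Variables (M : va_model) (j : 'I_J).

Definition class_avg (H : student -> 'I_T -> Omega -> R) (t : 'I_T)
    (w : Omega) : R :=
  (class_size M j)%:R^-1 * \sum_(i | teacher M i t == Some j) H i t w.

Definition Xbar (k : 'I_K) := class_avg (X M k).
Definition epsbar := class_avg (eps M).
Definition etabar := class_avg (eta M).

Definition Rbar (t : 'I_T) (w : Omega) : R :=
  class_avg (Robs M) t w - \sum_k Xbar k t w * beta0 M k ord0.

Definition demean (Hbar : 'I_T -> Omega -> R) (t : 'I_T) (w : Omega) : R :=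
  Hbar t w - T%:R^-1 * \sum_s Hbar s w.

Definition ddX (w : Omega) : 'M[R]_(T, K) :=
  \matrix_(t, k) demean (Xbar k) t w.
Definition dd (Hbar : 'I_T -> Omega -> R) (w : Omega) : 'cV[R]_T :=
  \col_t demean Hbar t w.

(* The entry phi_k of phi = (phi_1, ..., phi_(T-1))'. Vectors are indexed
   from 0, so phi_k is the entry of index k - 1; 0 if k is not in 1..T-1. *)
Definition lag_coef (phi : 'cV[R]_(T.-1)) (k : nat) : R :=
  \sum_(l < T.-1 | l.+1 == k) phi l ord0.

Definition predictor (phi : 'cV[R]_(T.-1)) (t : 'I_T) (w : Omega) : R :=
  \sum_(s | s != t) lag_coef phi `|s - t|%N * Rbar s w.

Definition mse (phi : 'cV[R]_(T.-1)) (t : 'I_T) : \bar R :=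
  'E_P[fun w => ((Rbar t w - predictor phi t w) ^+ 2)%R]%E.

Definition minimizes_mse (phi : 'cV[R]_(T.-1)) : Prop :=
  forall t phi', (mse phi t <= mse phi' t)%E.

Definition is_phi0 (phi0 : 'cV[R]_(T.-1)) : Prop :=
  minimizes_mse phi0 /\ forall phi, minimizes_mse phi -> phi = phi0.

Definition mu_mean0_stationary : Prop :=
  (forall t, 'E_P[mu M j t] = 0)%E /\
  exists rho : nat -> R, forall s t,
    correlation P (mu M j s) (mu M j t) = rho `|s - t|%N.

(* What makes the moments of mu, the mean squared errors for all phi, and
   Cov(etabar_t, mu*_t) = sum_(s != t) phi_|s-t| Cov(etabar_t, Rbar_s) exist
   and be finite; integrability of eps, eta and of the entries of the random
   matrices is part of the assumptions on them. *)
Definition finite_moments : Prop :=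
  [/\ (forall t, (mu M j t : Omega -> R) \in Lfun P 2%:E),
      (forall t, Rbar t \in Lfun P 2%:E) &
      (forall s t, s != t ->
        (fun w => etabar t w * mu M j s w) \in Lfun P 1%E)].

Definition eps_strictly_exogenous : Prop :=
  forall i t, teacher M i t = Some j ->
    is_cond_exp P (g_sigma_preimage (fun s => mu M j s : Omega -> R))
      (eps M i t) (cst (fine 'E_P[eps M i t]%E)) /\
    ('E_P[eps M i t] = 0)%E.

Definition eta_mean_indep_other_years : Prop :=
  forall i s t, teacher M i t = Some j -> s != t ->
    is_cond_exp P (g_sigma_algebra_preimage (mu M j s : Omega -> R))
      (eta M i t) (cst 0).

Definition shocks_indep_across_years : Prop :=
  forall s t, s != t ->
    indep_rv P (fun w => (epsbar t w, etabar t w))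
               (fun w => (epsbar s w, etabar s w)).

Definition ddX_gram_invertible : Prop :=
  mx_integrable P (fun w => (ddX w)^T *m ddX w) /\
  mx_expectation P (fun w => (ddX w)^T *m ddX w) \in unitmx.

Definition ddX_orthogonal (Hbar : 'I_T -> Omega -> R) : Prop :=
  mx_integrable P (fun w => (ddX w)^T *m dd Hbar w) /\
  mx_expectation P (fun w => (ddX w)^T *m dd Hbar w) = 0.

End ValueAdded.

(* Main.v *)
(* Averaging the score equation over a class gives Rbar_t = mu_t + epsbar_t.
   By (1a), (1b) and (1c) both epsbar_t and etabar_t are orthogonal to mu_s and
   to epsbar_s for every s != t, hence to every linear combination of the Rbar_s
   with s != t, in particular to mu*_t. This is the first claim, and it gives
   Cov(mu_t, mu*_t) = E[Rbar_t mu*_t]. Since a *: phi0 has predictor a mu*_t,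
   optimality of phi0 along this ray alone yields E[Rbar_t mu*_t] = E[mu*_t^2],
   and mu*_t is centered. *)
Require Import Defs.
From HB Require Import structures.
From mathcomp Require Import all_boot all_order all_algebra.
From mathcomp Require Import all_classical all_reals all_analysis.
From mathcomp Require Import finmap measurable_realfun ring.
Import Order.TTheory GRing.Theory Num.Theory.
Import numFieldNormedType.Exports.

Local Open Scope classical_set_scope.
Local Open Scope ring_scope.

Import HBSimple HBNNSimple.

(** * From conditional mean zero to orthogonality *)

Lemma integral_mul_sfun_comp_eq0 (R : realType) (d : measure_display)
    (T : measurableType d) (mu : {measure set T -> \bar R}) (X Z : T -> R)
    (g : {sfun R >-> R}) :
  mu.-integrable setT (EFin \o X) -> measurable_fun setT Z ->
  (forall B : set R, measurable B ->
    (\int[mu]_(w in Z @^-1` B) (X w)%:E = 0)%E) ->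
  (\int[mu]_w (X w * g (Z w))%:E = 0)%E.
Proof.
move=> iX mZ X0.
pose G (y : R) : set T := Z @^-1` (g @^-1` [set y]).
have mg y : measurable (g @^-1` [set y]) by exact: measurable_sfunP.
have mG y : measurable (G y).
  by rewrite /G -[X in measurable X]setTI; exact: mZ.
have GE w y : \1_(g @^-1` [set y]) (Z w) = \1_(G y) w :> R.
  by rewrite !indicE; congr (_%:R); apply/idP/idP; rewrite !inE.
have iG y : mu.-integrable setT (fun w => (X w * \1_(G y) w)%:E).
  apply: (le_integrable measurableT _ _ iX).
    apply/measurable_EFinP; apply: measurable_funM.
      by case/integrableP : iX => /measurable_EFinP.
    exact: measurable_indic.
  move=> w _ /=; rewrite lee_fin normrM ler_piMr// indicE.
  by case: (w \in G y); rewrite ?normr1 ?normr0.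
pose s : seq R := fset_set (range g).
(* A simple [g] takes finitely many values, so [X * g(Z)] is a finite combination of the
   restrictions of [X] to the events [G y]. Each such event is a preimage under [Z], where the
   integral of [X] vanishes by assumption. *)
have E w : (X w * g (Z w))%:E =
    (\sum_(y <- s) y%:E * (X w * \1_(G y) w)%:E)%E.
  rewrite fimfunE fsbig_finite//= big_distrr/= sumEFin; congr EFin.
  by apply: eq_bigr => y _; rewrite GE mulrCA.
under eq_integral do rewrite E.
rewrite integral_sum//; last by move=> y; exact: integrableZl.
rewrite big1// => y _; rewrite integralZl//.
rewrite [X in (_ * X)%E](_ : _ = 0%E) ?mule0//.
rewrite -[RHS](X0 _ (mg y)) [RHS]integral_mkcond.
apply: eq_integral => w _; rewrite patchE indicE.
by rewrite /G; case: (w \in _); rewrite ?mulr1 ?mulr0.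
Qed.

(** Since [h] is nonnegative, it is an increasing limit of simple functions. The integrable function
    [|X * h(Z)|] then serves as the bound for dominated convergence, and the case of simple
    functions passes to the limit. *)
Lemma integral_mul_nneg_comp_eq0 (R : realType) (d : measure_display)
    (T : measurableType d) (mu : {measure set T -> \bar R}) (X Z : T -> R)
    (h : R -> R) :
  mu.-integrable setT (EFin \o X) -> measurable_fun setT Z ->
  measurable_fun setT h -> (forall z, 0 <= h z) ->
  mu.-integrable setT (fun w => (X w * h (Z w))%:E) ->
  (forall B : set R, measurable B ->
    (\int[mu]_(w in Z @^-1` B) (X w)%:E = 0)%E) ->
  (\int[mu]_w (X w * h (Z w))%:E = 0)%E.
Proof.
move=> iX mZ mh h0 iXh X0.
have mX : measurable_fun setT X by case/integrableP : iX => /measurable_EFinP.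
have mEh : measurable_fun setT (EFin \o h) by exact/measurable_EFinP.
pose g := nnsfun_approx measurableT mEh.
have h0' x : setT x -> (0 <= (EFin \o h) x)%E by move=> _; rewrite lee_fin.
have gh z : g ^~ z @ \oo --> h z.
  by have /fine_cvgP[] := cvg_nnsfun_approx measurableT mEh h0' (I : setT z).
have ndg z : nondecreasing_seq (g ^~ z).
  by move=> m n mn; exact/lefP/nd_nnsfun_approx.
have gle n z : g n z <= h z.
  rewrite -(cvg_lim _ (gh z))//; apply: nondecreasing_cvgn_le => //.
  by apply/cvg_ex; exists (h z).
have g0 n : (\int[mu]_w (X w * g n (Z w))%:E = 0)%E.
  exact: integral_mul_sfun_comp_eq0.
have mgZ n : measurable_fun setT (fun w => X w * g n (Z w)).
  by apply: measurable_funM => //; exact: measurableT_comp.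
pose f_ n w : \bar R := (X w * g n (Z w))%:E.
have f_f : {ae mu, forall w, setT w -> f_ ^~ w @ \oo --> (X w * h (Z w))%:E}.
  apply/aeW => w _; apply/cvg_EFin; first exact: nearW.
  by apply: cvgMr; exact: gh.
have f_le : {ae mu, forall w n, setT w ->
    (`|f_ n w| <= `|(X w * h (Z w))%:E|)%E}.
  apply/aeW => w n _; rewrite /= lee_fin !normrM ler_wpM2l//.
  by rewrite !ger0_norm//; exact: fun_ge0.
have mf_ n : measurable_fun setT (f_ n) by exact/measurable_EFinP.
(* Monotone simple approximations of [h] are dominated by [h]. *)
have [_ _ /cvg_lim <-//] := dominated_convergence measurableT mf_
  (measurable_int _ iXh) f_f (integrable_abse iXh) f_le.
by under eq_fun do rewrite g0; exact: lim_cst.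
Qed.

(** This turns E[X | Z] = 0, expressed through events, into E[X Z] = 0. The positive and negative
    parts of [Z] are nonnegative functions of [Z] bounded by [|Z|], so integrability of [X * Z]
    passes to both pieces. *)
Lemma integral_mul_eq0 (R : realType) (d : measure_display)
    (T : measurableType d) (mu : {measure set T -> \bar R}) (X Z : T -> R) :
  mu.-integrable setT (EFin \o X) -> measurable_fun setT Z ->
  mu.-integrable setT (fun w => (X w * Z w)%:E) ->
  (forall B : set R, measurable B ->
    (\int[mu]_(w in Z @^-1` B) (X w)%:E = 0)%E) ->
  (\int[mu]_w (X w * Z w)%:E = 0)%E.
Proof.
move=> iX mZ iXZ X0.
have mX : measurable_fun setT X by case/integrableP : iX => /measurable_EFinP.
have iXh (h : R -> R) : measurable_fun setT h -> (forall z, `|h z| <= `|z|) ->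
    mu.-integrable setT (fun w => (X w * h (Z w))%:E).
  move=> mh hle; apply: (le_integrable measurableT _ _ iXZ).
    apply/measurable_EFinP; apply: measurable_funM => //.
    exact: measurableT_comp.
  by move=> w _; rewrite /= lee_fin !normrM ler_wpM2l.
pose hp (z : R) := Num.max z 0; pose hn (z : R) := Num.max (- z) 0.
have mhp : measurable_fun setT hp by exact: measurable_maxr.
have mhn : measurable_fun setT hn.
  by apply: measurable_maxr => //; exact: measurable_oppr.
have hpn z : z = hp z - hn z.
  have [z0|/ltW z0] := lerP 0 z.
    by rewrite /hp /hn max_l// max_r ?oppr_le0// subr0.
  by rewrite /hp /hn max_r// max_l ?oppr_ge0// sub0r opprK.
have hp_le z : `|hp z| <= `|z|.
  have [z0|/ltW z0] := lerP 0 z; first by rewrite /hp max_l.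
  by rewrite /hp max_r// normr0.
have hn_le z : `|hn z| <= `|z| by rewrite -(normrN z); exact: hp_le.
under eq_integral => w _ do rewrite (hpn (Z w)) mulrBr EFinB.
rewrite integralB//; [|exact: iXh|exact: iXh].
have hp0 z : 0 <= hp z by rewrite le_max lexx orbT.
rewrite !integral_mul_nneg_comp_eq0 ?sube0//; try exact: iXh.
by move=> z; exact: hp0.
Qed.

(** * Independence and products of integrable variables *)

Lemma indep_rv_comp (R : realType) (d d1 d2 d3 d4 : measure_display)
    (Omega : measurableType d) (P : probability Omega R)
    (T1 : measurableType d1) (T2 : measurableType d2)
    (T3 : measurableType d3) (T4 : measurableType d4)
    (U : Omega -> T1) (V : Omega -> T2) (f : T1 -> T3) (g : T2 -> T4) :
  measurable_fun setT f -> measurable_fun setT g ->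
  indep_rv P U V ->
  indep_rv P (f \o U) (g \o V).
Proof.
move=> mf mg UV A B mA mB; apply: (UV (f @^-1` A) (g @^-1` B)).
  by rewrite -[X in measurable X]setTI; exact: mf.
by rewrite -[X in measurable X]setTI; exact: mg.
Qed.

Section indep_product.
Context (R : realType) (d : measure_display) (Omega : measurableType d).
Variables (P : probability Omega R) (U V : {RV P >-> R}).
Hypothesis UV : indep_rv P (U : Omega -> R) (V : Omega -> R).

Let W w := (U w, V w).
Let mW : measurable_fun setT W.
Proof. exact: measurable_fun_pair. Qed.
HB.instance Definition _ := isMeasurableFun.Build _ _ _ _ W mW.

(** Independence says that the law of the pair agrees with the product of the laws on measurable
    rectangles, and these determine the product measure. *)
Lemma distribution_pair_indep (A : set (R * R)) : measurable A ->
  (distribution P U \x distribution P V)%E A = distribution P W A.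
Proof.
by move=> mA; exact: product_measure_unique.
Qed.

Let mulE (z : R * R) := (z.1 * z.2)%:E.
Let m_mulE : measurable_fun setT mulE.
Proof. by apply/measurable_EFinP; exact: measurable_funM. Qed.

(** Tonelli's theorem in [0, +oo]. It yields integrability of the product, which has to precede the
    use of Fubini's theorem on the signed product. *)
Lemma integral_norm_mul_indep :
  (\int[P]_w `|(U w * V w)%:E| =
   \int[P]_w `|(U w)%:E| * \int[P]_w `|(V w)%:E|)%E.
Proof.
have m_abs : measurable_fun setT (fun x : R => `|x%:E|%E).
  exact: measurableT_comp.
transitivity (\int[distribution P W]_z `|mulE z|)%E.
  by rewrite ge0_integral_distribution//; exact: measurableT_comp.
rewrite -(eq_measure_integral _ (fun A mA _ => distribution_pair_indep A mA)).
rewrite fubini_tonelli1//; last exact: measurableT_comp.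
under eq_integral => x _.
  rewrite /fubini_F/=.
  under eq_integral => y _ do rewrite normrM EFinM.
  rewrite ge0_integralZl ?lee_fin//.
  over.
rewrite ge0_integralZr//; last exact: integral_ge0.
by rewrite !ge0_integral_distribution.
Qed.

Hypotheses (U1 : (U : Omega -> R) \in Lfun P 1)
  (V1 : (V : Omega -> R) \in Lfun P 1).

Lemma Lfun1_mul_indep : (fun w => U w * V w) \in Lfun P 1.
Proof.
have /Lfun1_integrable/integrableP[_ iU] := U1.
have /Lfun1_integrable/integrableP[_ iV] := V1.
apply/Lfun1_integrable/integrableP; split.
  by apply/measurable_EFinP; exact: measurable_funM.
rewrite /comp integral_norm_mul_indep lte_mul_pinfty//; first exact: integral_ge0.
by rewrite ge0_fin_numE//; exact: integral_ge0.
Qed.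

Lemma expectation_mul_indep :
  ('E_P[fun w => (U w * V w)%R] = 'E_P[U] * 'E_P[V])%E.
Proof.
have iUV := (Lfun1_integrable _ _).1 Lfun1_mul_indep.
have iU := (Lfun1_integrable _ _).1 U1.
have iV := (Lfun1_integrable _ _).1 V1.
rewrite unlock.
transitivity (\int[distribution P W]_z mulE z)%E.
  by rewrite integral_distribution.
(* The integrability required by Fubini is carried from [P] to the law of the pair, which is the
   product law. *)
have imulE : (distribution P U \x distribution P V)%E.-integrable setT mulE.
  apply/integrableP; split => //.
  rewrite (eq_measure_integral (distribution P W)); last first.
    by move=> A mA _; exact: distribution_pair_indep.
  rewrite ge0_integral_distribution//; last exact: measurableT_comp.
  by case/integrableP : iUV.
rewrite -(eq_measure_integral _ (fun A mA _ => distribution_pair_indep A mA)).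
rewrite -integral12_prod_meas1//.
have iV' : (distribution P V).-integrable setT EFin.
  exact: integrable_pushforward.
have iU' : (distribution P U).-integrable setT EFin.
  exact: integrable_pushforward.
under eq_integral => x _.
  rewrite /fubini_F /mulE/=.
  under eq_integral => y _ do rewrite EFinM.
  rewrite integralZl//.
  over.
(* The inner integral is finite; writing it as an embedded real lets it be pulled out as a
   scalar. *)
rewrite -(fineK (integrable_fin_num _ iV'))// integralZr//.
by rewrite fineK ?integrable_fin_num// !integral_distribution.
Qed.

End indep_product.

(** * Class averages and the linear predictor *)

Section class_average.
Context (R : realType) (d : measure_display) (Omega : measurableType d).
Variables (P : probability Omega R) (J T K : nat) (student : finType).
Variables (M : va_model P J T K student) (j : 'I_J).
Implicit Types (H : student -> 'I_T -> Omega -> R) (t : 'I_T).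

Lemma class_avg_Lfun1 H t :
  (forall i, teacher M i t = Some j -> H i t \in Lfun P 1) ->
  class_avg M j H t \in Lfun P 1.
Proof.
move=> H1.
have -> : class_avg M j H t = (class_size M j)%:R^-1 *:
    \sum_(i | teacher M i t == Some j) H i t.
  by apply/funext => w; rewrite fct_sumE.
by rewrite rpredZ// rpred_sum// => i /eqP; exact: H1.
Qed.

Lemma integral_class_avg_eq0 H t (A : set Omega) : measurable A ->
  (forall i, teacher M i t = Some j -> H i t \in Lfun P 1) ->
  (forall i, teacher M i t = Some j -> \int[P]_(w in A) (H i t w)%:E = 0)%E ->
  (\int[P]_(w in A) (class_avg M j H t w)%:E = 0)%E.
Proof.
move=> mA H1 H0.
(* Extension by zero outside the class: the sum then runs over all students with every term
   integrable, although nothing is assumed about [H i t] for students of other classes. *)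
pose F i w : \bar R :=
  if teacher M i t == Some j then (H i t w)%:E else 0%E.
have iF i : P.-integrable A (F i).
  rewrite /F; case: eqP => [/H1/Lfun1_integrable iH|_]; last exact: integrable0.
  exact: integrableS iH.
have E w : (class_avg M j H t w)%:E =
    ((class_size M j)%:R^-1%:E * \sum_i F i w)%E.
  by rewrite /class_avg EFinM -sumEFin big_mkcond.
under eq_integral do rewrite E.
rewrite integralZl//; last exact: integrable_sum.
rewrite integral_sum// big1 ?mule0// => i _; rewrite /F.
by case: eqP => [/H0//|_]; rewrite integral0.
Qed.

Lemma RbarE t w : Rbar M j t w = mu M j t w + epsbar M j t w.
Proof.
have n0 : (class_size M j)%:R != 0 :> R.
  by rewrite pnatr_eq0 -lt0n class_size_gt0.
(* Value added is common to the class, so it is counted [class_size] times; the division by the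
   class size cancels because the class is nonempty. *)
have E : \sum_(i | teacher M i t == Some j) Robs M i t w =
    \sum_k (\sum_(i | teacher M i t == Some j) X M k i t w) * beta0 M k ord0
    + (class_size M j)%:R * mu M j t w
    + \sum_(i | teacher M i t == Some j) eps M i t w.
  rewrite (eq_bigr (fun i => \sum_k X M k i t w * beta0 M k ord0
      + mu M j t w + eps M i t w)); last by move=> i /eqP /RobsE ->.
  rewrite !big_split/= exchange_big/= sumr_const -(card_class M j t) cardsE.
  rewrite mulr_natl; congr (_ + _ + _).
  by apply: eq_bigr => k _; rewrite mulr_suml.
rewrite /Rbar {1}/class_avg E !mulrDr mulKf// mulr_sumr.
rewrite [X in X - _](_ : _ = \sum_k Xbar M j k t w * beta0 M k ord0
    + mu M j t w + epsbar M j t w); last first.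
  by congr (_ + _ + _); apply: eq_bigr => k _; rewrite mulrA.
by apply/eqP; rewrite subr_eq [eqbRHS]addrC addrA.
Qed.

Lemma predictorZ (a : R) (phi : 'cV[R]_(T.-1)) t w :
  predictor M j (a *: phi) t w = a * predictor M j phi t w.
Proof.
rewrite /predictor mulr_sumr; apply: eq_bigr => s _; rewrite mulrA; congr (_ * _).
by rewrite /lag_coef mulr_sumr; apply: eq_bigr => l _; rewrite mxE.
Qed.

Lemma predictor_funE (phi : 'cV[R]_(T.-1)) t : predictor M j phi t =
  \sum_(s | s != t) lag_coef phi `|s - t|%N *: Rbar M j s.
Proof. by apply/funext => w; rewrite fct_sumE. Qed.

Lemma predictor_Lfun2 (phi : 'cV[R]_(T.-1)) t :
  (forall s, Rbar M j s \in Lfun P 2%:E) ->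
  predictor M j phi t \in Lfun P 2%:E.
Proof.
move=> R2; rewrite predictor_funE; elim/big_ind : _ => [|f g f2 g2|s _].
- by rewrite rpred0 ?lee1n.
- by rewrite rpredD ?lee1n.
- by rewrite rpredZ ?lee1n.
Qed.

(** Linearity reduces the predictor to single years. The cases of interest are [Y] equal to
    [etabar], to [epsbar], and to the constant 1, which centers the predictor. *)
Lemma predictor_orthogonal (Y : Omega -> R) (phi : 'cV[R]_(T.-1)) t :
  (forall s, s != t -> (fun w => Y w * Rbar M j s w) \in Lfun P 1) ->
  (forall s, s != t -> 'E_P[fun w => (Y w * Rbar M j s w)%R] = 0)%E ->
  (fun w => Y w * predictor M j phi t w) \in Lfun P 1 /\
  ('E_P[fun w => (Y w * predictor M j phi t w)%R] = 0)%E.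
Proof.
move=> YR1 YR0.
(* The term of year [t] is set to 0, since [Y * Rbar] is controlled in the other years only. *)
pose F s : Omega -> R := if s != t then
  lag_coef phi `|s - t|%N \o* (fun w => Y w * Rbar M j s w) else cst 0.
have -> : (fun w => Y w * predictor M j phi t w) =
    \sum_(f <- [seq F s | s : 'I_T]) f.
  apply/funext => w; rewrite big_image fct_sumE /predictor mulr_sumr big_mkcond.
  apply: eq_bigr => s _; rewrite /F; case: ifP => //= _.
  by rewrite mulrCA mulrC.
have F1 f : f \in [seq F s | s : 'I_T] -> f \in Lfun P 1.
  move=> /mapP[s _ ->]; rewrite /F; case: ifPn => [st|_]; last exact: Lfun_cst.
  by rewrite Lfun_scale// YR1.
split; first by rewrite big_seq rpred_sum.
rewrite expectation_sum// big_image big1//= => s _; rewrite /F.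
case: ifPn => [st|_]; last exact: expectation_cst.
by rewrite expectationZl ?YR1// YR0// mule0.
Qed.

End class_average.

(** * The first-order condition of least squares along a ray *)

Lemma minimizer_scaling_orthogonal (R : realType) (d : measure_display)
    (Omega : measurableType d) (P : probability Omega R) (Y Z : Omega -> R) :
  Y \in Lfun P 2%:E -> Z \in Lfun P 2%:E ->
  (forall a : R, ('E_P[fun w => ((Y w - Z w) ^+ 2)%R] <=
    'E_P[fun w => ((Y w - a * Z w) ^+ 2)%R])%E) ->
  ('E_P[fun w => (Y w * Z w)%R] = 'E_P[fun w => (Z w * Z w)%R])%E.
Proof.
move=> Y2 Z2 min.
have YY1 := Lfun2_mul_Lfun1 Y2 Y2.
have YZ1 := Lfun2_mul_Lfun1 Y2 Z2.
have ZZ1 := Lfun2_mul_Lfun1 Z2 Z2.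
have yyE := fineK (expectation_fin_num YY1).
have yzE := fineK (expectation_fin_num YZ1).
have zzE := fineK (expectation_fin_num ZZ1).
set yy := fine _ in yyE; set yz := fine _ in yzE; set zz := fine _ in zzE.
(* Square integrability makes the three second moments real, so the mean squared error is a real
   quadratic polynomial in [a]. *)
have mseE a : ('E_P[fun w => ((Y w - a * Z w) ^+ 2)%R] =
    (yy - 2 * a * yz + a ^+ 2 * zz)%:E)%E.
  have -> : (fun w => (Y w - a * Z w) ^+ 2) =
      (Y \* Y) \+ ((- (2 * a)) \o* (Y \* Z)) \+ ((a ^+ 2) \o* (Z \* Z)).
    by apply/funext => w /=; ring.
  rewrite !expectationD ?rpredD ?Lfun_scale// !expectationZl//.
  by rewrite -yyE -yzE -zzE -!EFinM -!EFinD; congr EFin; ring.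
have zz0 : 0 <= zz.
  by rewrite -lee_fin zzE expectation_ge0// => w; exact: sqr_ge0.
rewrite -[LHS]yzE -[RHS]zzE; congr EFin; apply/eqP; rewrite -subr_eq0.
(* The increment of the mean squared error from scale [1] to scale [1 + b] is
   [b ^+ 2 * zz - 2 * b * (yz - zz)]; take [b = (yz - zz) / (zz + 1)]. *)
pose b := (yz - zz) / (zz + 1).
have bE : yz - zz = b * (zz + 1) by rewrite divfK// gt_eqF// ltr_wpDl.
have := min (1 + b); have := mseE 1; under eq_fun do rewrite mul1r.
move=> ->; rewrite mseE lee_fin => le1b.
(* For this [b] the increment equals [- b ^+ 2 * (zz + 2)], and minimality at scale 1 makes it
   nonnegative; hence [b = 0]. The 1 added in the denominator of [b] covers the case [zz = 0]. *)
have b0 : b ^+ 2 * (zz + 2) <= 0.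
  suff -> : b ^+ 2 * (zz + 2) = (yy - 2 * 1 * yz + 1 ^+ 2 * zz) -
      (yy - 2 * (1 + b) * yz + (1 + b) ^+ 2 * zz) by rewrite subr_le0.
  have -> : yz = zz + b * (zz + 1) by rewrite -bE; ring.
  by ring.
have : b ^+ 2 == 0.
  by move: b0; rewrite pmulr_lle0 ?ltr_wpDl// eq_le sqr_ge0 andbT.
by rewrite bE sqrf_eq0 => /eqP ->; rewrite mul0r.
Qed.

(** * Orthogonality of the class shocks to value added and to other shocks *)

Section orthogonality.
Context (R : realType) (d : measure_display) (Omega : measurableType d).
Variables (P : probability Omega R) (J T K : nat) (student : finType).
Variables (M : va_model P J T K student) (j : 'I_J).

Lemma expectation_class_avg_eq0 (H : student -> 'I_T -> Omega -> R) t :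
  (forall i, teacher M i t = Some j -> H i t \in Lfun P 1) ->
  (forall i, teacher M i t = Some j -> 'E_P[H i t] = 0)%E ->
  ('E_P[class_avg M j H t] = 0)%E.
Proof.
by rewrite unlock => H1 H0; rewrite integral_class_avg_eq0.
Qed.

Lemma class_avg_orthogonal (H : student -> 'I_T -> Omega -> R) t
    (Z : Omega -> R) :
  measurable_fun setT Z ->
  (forall i, teacher M i t = Some j -> H i t \in Lfun P 1) ->
  (forall i, teacher M i t = Some j -> forall B : set R, measurable B ->
    \int[P]_(w in Z @^-1` B) (H i t w)%:E = 0)%E ->
  (fun w => class_avg M j H t w * Z w) \in Lfun P 1 ->
  ('E_P[fun w => (class_avg M j H t w * Z w)%R] = 0)%E.
Proof.
move=> mZ H1 H0 HZ1; rewrite unlock; apply: integral_mul_eq0 => //.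
- exact/Lfun1_integrable/class_avg_Lfun1.
- exact/Lfun1_integrable.
- move=> B mB; apply: integral_class_avg_eq0 => // [|i it].
    by rewrite -[X in measurable X]setTI; exact: mZ.
  exact: H0.
Qed.

Lemma epsbar_Lfun1_centered t : eps_strictly_exogenous M j ->
  epsbar M j t \in Lfun P 1 /\ ('E_P[epsbar M j t] = 0)%E.
Proof.
move=> h1a; have H1 i : teacher M i t = Some j ->
    (eps M i t : Omega -> R) \in Lfun P 1 by case/h1a => -[].
split; first exact: class_avg_Lfun1.
by apply: expectation_class_avg_eq0 => // i /h1a[].
Qed.

Lemma epsbar_mu_orthogonal s t : eps_strictly_exogenous M j ->
  (fun w => epsbar M j t w * mu M j s w) \in Lfun P 1 ->
  ('E_P[fun w => (epsbar M j t w * mu M j s w)%R] = 0)%E.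
Proof.
move=> h1a; apply: class_avg_orthogonal => // i /h1a[[]]//.
move=> _ _ _ intE eps0 B mB; rewrite intE ?eps0/= ?integral0//.
(* An event about value added in the single year [s] is a generator of the sigma-algebra of the
   whole vector, so conditioning on the vector covers it. *)
apply: sub_sigma_algebra; rewrite (bigD1 s)//=; left.
by exists B => //; rewrite setTI.
Qed.

Lemma etabar_Lfun1 s t : eta_mean_indep_other_years M j -> s != t ->
  etabar M j t \in Lfun P 1.
Proof. by move=> h1b st; apply: class_avg_Lfun1 => i /h1b/(_ st)[]. Qed.

Lemma etabar_mu_orthogonal s t : eta_mean_indep_other_years M j -> s != t ->
  (fun w => etabar M j t w * mu M j s w) \in Lfun P 1 ->
  ('E_P[fun w => (etabar M j t w * mu M j s w)%R] = 0)%E.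
Proof.
move=> h1b st; apply: class_avg_orthogonal => // i /h1b/(_ st)[]//.
move=> _ _ _ intE B mB; rewrite intE ?integral0//.
by exists B => //; rewrite setTI.
Qed.

Lemma indep_orthogonal (U V : Omega -> R) :
  U \in Lfun P 1 -> V \in Lfun P 1 -> indep_rv P U V -> ('E_P[V] = 0)%E ->
  (fun w => U w * V w) \in Lfun P 1 /\ ('E_P[fun w => (U w * V w)%R] = 0)%E.
Proof.
move=> U1 V1 UV V0.
have /Lfun1_integrable/integrableP[/measurable_EFinP mU _] := U1.
have /Lfun1_integrable/integrableP[/measurable_EFinP mV _] := V1.
pose U' : {RV P >-> R} := HB.pack U (isMeasurableFun.Build _ _ _ _ U mU).
pose V' : {RV P >-> R} := HB.pack V (isMeasurableFun.Build _ _ _ _ V mV).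
split; first exact: (@Lfun1_mul_indep _ _ _ P U' V').
by rewrite (@expectation_mul_indep _ _ _ P U' V')// V0 mule0.
Qed.

Lemma Rbar_orthogonal (Y : Omega -> R) s :
  (fun w => Y w * mu M j s w) \in Lfun P 1 ->
  (fun w => Y w * epsbar M j s w) \in Lfun P 1 ->
  ('E_P[fun w => (Y w * mu M j s w)%R] = 0)%E ->
  ('E_P[fun w => (Y w * epsbar M j s w)%R] = 0)%E ->
  (fun w => Y w * Rbar M j s w) \in Lfun P 1 /\
  ('E_P[fun w => (Y w * Rbar M j s w)%R] = 0)%E.
Proof.
move=> Ymu1 Yeps1 Ymu0 Yeps0.
have -> : (fun w => Y w * Rbar M j s w) =
    (fun w => Y w * mu M j s w) \+ (fun w => Y w * epsbar M j s w).
  by apply/funext => w /=; rewrite RbarE mulrDr.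
by rewrite expectationD// Ymu0 Yeps0 adde0; split => //; rewrite rpredD.
Qed.

End orthogonality.

(** Centering one factor reduces the covariance to a cross moment; the centered factor will be the
    predictor. *)
Lemma covariance_centered (R : realType) (d : measure_display)
    (Omega : measurableType d) (P : probability Omega R) (Y Z : Omega -> R) :
  Y \in Lfun P 1 -> Z \in Lfun P 1 -> (fun w => Y w * Z w) \in Lfun P 1 ->
  ('E_P[Z] = 0)%E -> (covariance P Y Z = 'E_P[fun w => (Y w * Z w)%R])%E.
Proof. by move=> Y1 Z1 YZ1 Z0; rewrite covarianceE// Z0 mule0 sube0. Qed.

(** * Assembly of the moment conditions *)

Theorem mainTheorem2 (R : realType) (d : measure_display)
    (Omega : measurableType d) (P : probability Omega R)
    (J T K : nat) (student : finType) (hT : (2 <= T)%N)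
    (M : va_model P J T K student) (j : 'I_J) (phi0 : 'cV[R]_(T.-1))
    (hmu : mu_mean0_stationary M j)
    (hfin : finite_moments M j)
    (hphi0 : is_phi0 M j phi0)
    (h1a : eps_strictly_exogenous M j)
    (h1b : eta_mean_indep_other_years M j)
    (h1c : shocks_indep_across_years M j)
    (h2a : ddX_gram_invertible M j)
    (h2b : forall t : 'I_T,
      (0 < 'V_P[predictor M j phi0 t])%E /\
      ('V_P[predictor M j phi0 t] < +oo)%E)
    (h2c : [/\ ddX_orthogonal M j (mu M j),
               ddX_orthogonal M j (epsbar M j) &
               ddX_orthogonal M j (etabar M j)]) :
  forall t : 'I_T,
    (covariance P (etabar M j t) (predictor M j phi0 t) = 0)%E /\
    (covariance P (mu M j t) (predictor M j phi0 t)
       / 'V_P[predictor M j phi0 t] = 1)%E.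
Proof.
move=> t; have [mu2 R2 etamu1] := hfin; have [mu0 _] := hmu.
(* A second year exists because [T] is at least 2. Applied to the pair [r], [t], (1b) provides the
   integrability of [etabar] in year [t]. *)
have [r rt] : exists r, r != t.
  have [t0|t0] := eqVneq t (Ordinal (ltnW hT)).
    by exists (Ordinal hT); rewrite t0.
  by exists (Ordinal (ltnW hT)); rewrite eq_sym.
have sub12 := Lfun_subset12 (fin_num_measure P _ measurableT).
set m := predictor M j phi0 t.
have m2 : m \in Lfun P 2%:E by exact: predictor_Lfun2.
have m1 := sub12 _ m2.
have eps1 s := (epsbar_Lfun1_centered _ _ _ _ _ _ _ _ M j s h1a).1.
have eps0 s := (epsbar_Lfun1_centered _ _ _ _ _ _ _ _ M j s h1a).2.
(* As a difference of two square integrable variables, [epsbar] is square integrable, which makes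
   its products with value added integrable. For [etabar] the corresponding integrability is part of
   [finite_moments]. *)
have eps2 s : epsbar M j s \in Lfun P 2%:E.
  have -> : epsbar M j s = Rbar M j s \- mu M j s.
    by apply/funext => w; rewrite /= RbarE addrC addKr.
  by rewrite rpredB ?lee1n.
have eta1 := etabar_Lfun1 _ _ _ _ _ _ _ _ M j r t h1b rt.
(* (1c) is about pairs of shocks; coordinate projections extract the two independences from [epsbar]
   in year [s], the only shock in [Rbar] of that year. *)
have indep_eps s : s != t -> indep_rv P (epsbar M j t) (epsbar M j s).
  by move=> /h1c; exact: (indep_rv_comp _ _ _ _ _ _ _ _ _ _ _ _ _ _ fst fst).
have indep_eta s : s != t -> indep_rv P (etabar M j t) (epsbar M j s).
  by move=> /h1c; exact: (indep_rv_comp _ _ _ _ _ _ _ _ _ _ _ _ _ _ snd fst).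
(* Orthogonality to the constant 1 means that the predictor has mean zero. *)
have [_ m0'] : (fun w => cst 1 w * m w) \in Lfun P 1 /\
    ('E_P[fun w => (cst 1 w * m w)%R] = 0)%E.
  have R0 s : ('E_P[Rbar M j s] = 0)%E.
    have -> : Rbar M j s = mu M j s \+ epsbar M j s.
      by apply/funext => w; exact: RbarE.
    by rewrite expectationD ?sub12// mu0 eps0 adde0.
  have oneR s : (fun w => cst 1 w * Rbar M j s w) = Rbar M j s.
    by apply/funext => w; rewrite mul1r.
  by apply: predictor_orthogonal => s _; rewrite oneR ?sub12.
have m0 : ('E_P[m] = 0)%E.
  by rewrite -m0'; congr expectation; apply/funext => w; rewrite mul1r.
have [etam1 etam0] : (fun w => etabar M j t w * m w) \in Lfun P 1 /\
    ('E_P[fun w => (etabar M j t w * m w)%R] = 0)%E.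
  have etaR s : s != t ->
      (fun w => etabar M j t w * Rbar M j s w) \in Lfun P 1 /\
      ('E_P[fun w => (etabar M j t w * Rbar M j s w)%R] = 0)%E.
    move=> st.
    have [etaeps1 etaeps0] :=
      indep_orthogonal _ _ _ P _ _ eta1 (eps1 s) (indep_eta s st) (eps0 s).
    have etamu1' : (fun w => etabar M j t w * mu M j s w) \in Lfun P 1.
      exact: etamu1.
    by apply: Rbar_orthogonal => //; exact: etabar_mu_orthogonal.
  by apply: predictor_orthogonal => s /etaR[].
have [epsm1 epsm0] : (fun w => epsbar M j t w * m w) \in Lfun P 1 /\
    ('E_P[fun w => (epsbar M j t w * m w)%R] = 0)%E.
  have epsR s : s != t ->
      (fun w => epsbar M j t w * Rbar M j s w) \in Lfun P 1 /\
      ('E_P[fun w => (epsbar M j t w * Rbar M j s w)%R] = 0)%E.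
    move=> st.
    have [epseps1 epseps0] :=
      indep_orthogonal _ _ _ P _ _ (eps1 t) (eps1 s) (indep_eps s st) (eps0 s).
    have epsmu1 : (fun w => epsbar M j t w * mu M j s w) \in Lfun P 1.
      exact: Lfun2_mul_Lfun1.
    by apply: Rbar_orthogonal => //; exact: epsbar_mu_orthogonal.
  by apply: predictor_orthogonal => s /epsR[].
have mum1 : (fun w => mu M j t w * m w) \in Lfun P 1 by exact: Lfun2_mul_Lfun1.
have mm1 : (fun w => m w * m w) \in Lfun P 1 by exact: Lfun2_mul_Lfun1.
split; first by rewrite covariance_centered.
have covE : (covariance P (mu M j t) m = 'V_P[m])%E.
  have mut1 := sub12 _ (mu2 t).
  rewrite /variance !covariance_centered//.
  rewrite -(minimizer_scaling_orthogonal _ _ _ P (Rbar M j t) m)// => [|a].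
    have -> : (fun w => Rbar M j t w * m w) =
        (fun w => mu M j t w * m w) \+ (fun w => epsbar M j t w * m w).
      by apply/funext => w /=; rewrite RbarE mulrDl.
    by rewrite expectationD// epsm0 adde0.
  (* The rescaled coefficient vector competes with [phi0], and its predictor is [a] times [m]. *)
  have := hphi0.1 t (a *: phi0); rewrite /mse.
  by under [X in (_ <= 'E_P[X])%E -> _]eq_fun do rewrite predictorZ.
(* In the extended reals, the quotient of the variance by itself is 1 once the variance is nonzero
   and finite; (2b) gives both. *)
have [Vm_gt0 Vm_lty] := h2b t.
by rewrite covE divee ?gt_eqF// ge0_fin_numE// ltW.
Qed.
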